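(* Let $\mathcal{H}_A,\mathcal{H}_B,\mathcal{H}_C$ be finite-dimensional Hilbert spaces. For any strictly positive definite density matrix $\rho_{AB}$ on $\mathcal{H}_A\otimes\mathcal{H}_B$ and any strictly positive definite density matrix $\sigma_{BC}$ on $\mathcal{H}_B\otimes\mathcal{H}_C$, $$(\log \rho_{AB})\otimes I_C - (\log \rho_A)\otimes I_{BC} + I_A\otimes \log \sigma_{BC} - I_{AB}\otimes \log \sigma_C \;\leq\; 0$$ as operators on $\mathcal{H}_A\otimes\mathcal{H}_B\otimes\mathcal{H}_C$.
   Context: A density matrix is a positive semidefinite operator of trace one. Marginals are partial traces: $\rho_A=\mathrm{Tr}_B\,\rho_{AB}$, $\sigma_C=\mathrm{Tr}_B\,\sigma_{BC}$. $I_X$ denotes the identity on $\mathcal{H}_X$; $\log$ is the matrix logarithm of a positive definite operator. For Hermitian operators, $X\leq 0$ means $-X$ is positive semidefinite. *)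

(* Defs.v *)
(* matrices over the complex numbers R[i], R : realType. *)
From HB Require Import structures.
From mathcomp Require Import all_boot all_order all_algebra.
From mathcomp Require Import complex mxtens.
From mathcomp Require Import reals exp.
Set Implicit Arguments. Unset Strict Implicit. Unset Printing Implicit Defensive.
Import Order.TTheory GRing.Theory Num.Theory.
Local Open Scope ring_scope.
Local Open Scope complex_scope.
Local Open Scope sesquilinear_scope.

(* Operators on C^n are n x n complex matrices; H_X ⊗ H_Y is C^(m*n) with the
   Kronecker product [tensmx] (index (i,j) |-> i*n + j). *)

Section QDefs.
Variable R : realType.
Local Notation C := (R[i]).

(* positive semidefinite: Hermitian with nonnegative quadratic form *)
Definition psdmx n (A : 'M[C]_n) : Prop :=
  A \is hermsymmx /\ forall v : 'rV[C]_n, 0 <= (v *m A *m v ^t*) 0 0.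

(* strictly positive definite *)
Definition posdefmx n (A : 'M[C]_n) : Prop :=
  A \is hermsymmx /\ forall v : 'rV[C]_n, v != 0 -> 0 < (v *m A *m v ^t*) 0 0.

(* density matrix: positive semidefinite with trace one *)
Definition density n (A : 'M[C]_n) : Prop := psdmx A /\ \tr A = 1.

(* partial traces on C^(m*n) = C^m ⊗ C^n *)
Definition ptrace2 m n (A : 'M[C]_(m * n)) : 'M[C]_m :=
  \matrix_(i, j) \sum_(k < n) A (mxtens_index (i, k)) (mxtens_index (j, k)).
Definition ptrace1 m n (A : 'M[C]_(m * n)) : 'M[C]_n :=
  \matrix_(i, j) \sum_(k < m) A (mxtens_index (k, i)) (mxtens_index (k, j)).

(* matrix logarithm via spectral decomposition A = P^* diag(λ) P, P unitary
   (meaningful for positive definite A, whose eigenvalues λ are real > 0) *)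
Definition logm n (A : 'M[C]_n) : 'M[C]_n :=
  (spectralmx A) ^t* *m
  diag_mx (\row_i ((ln (complex.Re (spectral_diag A 0 i)))%:C : C))
  *m spectralmx A.
End QDefs.

(* Main.v *)
(* With [X = rhoAB (x) sigmaC^-1] and [Y = rhoA (x) sigmaBC^-1] the claim reads
   [log X <= log Y], so by operator monotonicity of the logarithm it suffices to
   show [X <= Y].  This is linear in [rhoAB], so writing [rhoAB = G^* G] reduces
   it to inequalities, one per row of [G], which follow from the variational
   formula [u S^-1 u^* = sup_y { u y^* + y u^* - y S y^* }].  Monotonicity of the
   logarithm is obtained from that of the square root through
   [log X = lim 2^k (X^(1/2^k) - 1)]. *)
Require Import Defs.
From HB Require Import structures.
From mathcomp Require Import all_boot all_order all_algebra.
From mathcomp Require Import complex mxtens.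
From mathcomp Require Import reals sequences exp.
From mathcomp Require Import ring lra.
Set Implicit Arguments. Unset Strict Implicit. Unset Printing Implicit Defensive.
Import Order.TTheory GRing.Theory Num.Theory.
Local Open Scope ring_scope.
Local Open Scope complex_scope.
Local Open Scope sesquilinear_scope.

(** * Quadratic forms and operators diagonalised by a unitary with real eigenvalues *)

Section HermitianForms.
Variable R : realType.
Local Notation C := R[i].

Definition qform n (A : 'M[C]_n) (v : 'rV[C]_n) : C := (v *m A *m v ^t*) 0 0.

Lemma hermP n (A : 'M[C]_n) : reflect (A ^t* = A) (A \is hermsymmx).
Proof. by apply: (iffP (is_hermitianmxP _ _ _)); rewrite expr0 scale1r. Qed.

Lemma trmxC_mul m n p (A : 'M[C]_(m, n)) (B : 'M[C]_(n, p)) :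
  (A *m B) ^t* = B ^t* *m A ^t*.
Proof. by rewrite trmx_mul map_mxM. Qed.

Lemma trmxCB m n (A B : 'M[C]_(m, n)) : (A - B) ^t* = A ^t* - B ^t*.
Proof. by rewrite linearB /= raddfB. Qed.

Lemma qformB n (A B : 'M[C]_n) v : qform (A - B) v = qform A v - qform B v.
Proof. by rewrite /qform mulmxBr mulmxBl !mxE. Qed.

Lemma conj_rc (x : R) : (x%:C : C)^*%R = x%:C.
Proof. by apply: conj_Creal; rewrite complex_real. Qed.

Lemma posdef_psd n (A : 'M[C]_n) : posdefmx A -> psdmx A.
Proof.
move=> [hA pA]; split=> // v; have [->|/pA/ltW //] := eqVneq v 0.
by rewrite !mul0mx mxE.
Qed.

(** Functional calculus with the eigenbasis [U] kept as a parameter: applying a real function to the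
    operator only changes [d]. The eigenbasis need not be the one chosen by [spectralmx], so
    products, roots and tensor products stay in this form. *)
Definition udiag n (U : 'M[C]_n) (d : 'I_n -> R) : 'M[C]_n :=
  U ^t* *m diag_mx (\row_i (d i)%:C) *m U.

Lemma udiag_herm n (U : 'M[C]_n) d : udiag U d \is hermsymmx.
Proof.
apply/hermP; rewrite /udiag !trmxC_mul trmxCK mulmxA; congr (_ *m _ *m _).
rewrite tr_diag_mx map_diag_mx; congr diag_mx; apply/rowP=> i.
by rewrite !mxE; exact: conj_rc.
Qed.

Lemma qform_udiag n (U : 'M[C]_n) d v :
  qform (udiag U d) v = \sum_i (d i)%:C * `|(v *m U ^t*) 0 i| ^+ 2.
Proof.
rewrite /qform /udiag !mulmxA -[_ *m U *m _]mulmxA.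
have -> : U *m v ^t* = (v *m U ^t*) ^t* by rewrite trmxC_mul trmxCK.
rewrite mul_mx_diag mxE; apply: eq_bigr => i _.
by rewrite !mxE normCK mulrCA mulrA.
Qed.

Lemma udiag_psd n (U : 'M[C]_n) d : (forall i, 0 <= d i) -> psdmx (udiag U d).
Proof.
move=> d0; split=> [|v]; first exact: udiag_herm.
rewrite -/(qform _ _) qform_udiag sumr_ge0 // => i _.
by rewrite mulr_ge0 ?exprn_ge0 // ler0c.
Qed.

Lemma unitaryVmx n (U : 'M[C]_n) : U \is unitarymx -> U ^t* *m U = 1%:M.
Proof. by move=> /unitarymxP/mulmx1C. Qed.

Lemma udiag_posdef n (U : 'M[C]_n) d : U \is unitarymx ->
  (forall i, 0 < d i) -> posdefmx (udiag U d).
Proof.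
move=> uU d0; split=> [|v v0]; first exact: udiag_herm.
rewrite -/(qform _ _) qform_udiag lt_neqAle eq_sym; apply/andP; split; last first.
  by apply: sumr_ge0 => i _; rewrite mulr_ge0 ?exprn_ge0 // ler0c ltW.
apply: contra v0 => /eqP/psumr_eq0P s0.
suff w0 : v *m U ^t* = 0.
  by rewrite -[v]mulmx1 -(unitaryVmx uU) mulmxA w0 mul0mx.
apply/rowP=> i; rewrite [RHS]mxE.
have /eqP : (d i)%:C * `|(v *m U ^t*) 0 i| ^+ 2 = 0.
  by apply: s0 => // j _; rewrite mulr_ge0 ?exprn_ge0 // ler0c ltW.
rewrite mulf_eq0 expf_eq0 normr_eq0 /= => /orP[|/eqP //].
by rewrite eq_complex /= eqxx andbT (gt_eqF (d0 i)).
Qed.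

Lemma udiagM n (U : 'M[C]_n) d e : U \is unitarymx ->
  udiag U d *m udiag U e = udiag U (fun i => d i * e i).
Proof.
move=> /unitarymxP uU; rewrite /udiag !mulmxA.
rewrite -[_ *m U *m _]mulmxA uU mulmx1 -[_ *m diag_mx _ *m diag_mx _]mulmxA.
rewrite mulmx_diag; congr (_ *m diag_mx _ *m _).
by apply/rowP=> i; rewrite !mxE rmorphM.
Qed.

Lemma eq_udiag n (U : 'M[C]_n) d e : d =1 e -> udiag U d = udiag U e.
Proof.
move=> de; rewrite /udiag; congr (_ *m diag_mx _ *m _).
by apply/rowP=> i; rewrite !mxE de.
Qed.

Lemma udiag1 n (U : 'M[C]_n) : U \is unitarymx -> udiag U (fun=> 1) = 1%:M.
Proof.
move=> uU; rewrite /udiag (_ : diag_mx _ = 1%:M) ?mulmx1 ?unitaryVmx //.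
by rewrite -diag_const_mx; congr diag_mx; apply/rowP=> i; rewrite !mxE.
Qed.

Lemma herm_udiag n (A : 'M[C]_n) : A \is hermsymmx ->
  A = udiag (spectralmx A) (fun i => complex.Re (spectral_diag A 0 i)).
Proof.
move=> hA; have /hermitian_normalmx/orthomx_spectralP {1}-> := hA.
rewrite invmx_unitary ?spectral_unitarymx // /udiag.
congr (_ *m diag_mx _ *m _); apply/rowP=> i; rewrite mxE RRe_real //.
by have /mxOverP := hermitian_spectral_diag_real hA; exact.
Qed.

Lemma udiag_eigen n (U : 'M[C]_n) d i : U \is unitarymx ->
  row i U *m udiag U d = (d i)%:C *: row i U.
Proof.
move=> /unitarymxP uU; rewrite /udiag !mulmxA -row_mul uU.
by rewrite -row_mul mul1mx row_diag_mx mxE -scalemxAl -rowE.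
Qed.

Lemma unitary_row_neq0 n (U : 'M[C]_n) i : U \is unitarymx -> row i U != 0.
Proof.
move=> /unitarymxP uU; apply/eqP => r0.
have := congr1 (row i) uU; rewrite row_mul r0 mul0mx => /rowP/(_ i)/eqP.
by rewrite !mxE eqxx eq_sym oner_eq0.
Qed.

(** Row [i] of [U] is a unit eigenvector, so the form evaluated there is exactly [d i]. *)
Lemma posdef_udiag_gt0 n (U : 'M[C]_n) d i : U \is unitarymx ->
  posdefmx (udiag U d) -> 0 < d i.
Proof.
move=> uU [_ /(_ _ (unitary_row_neq0 i uU))].
rewrite udiag_eigen // -scalemxAl mxE.
have /row_unitarymxP/(_ i i) := uU; rewrite dotmxE eqxx => ->.
by rewrite mulr1 ltcR.
Qed.

End HermitianForms.

(** * Operator monotonicity of the logarithm *)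

Section LogMonotone.
Variable R : realType.
Local Notation C := R[i].

(* If [r] is an eigenvector of [B - A] with eigenvalue [t], then
   [r (B^2 - A^2) r^* = t * r (A + B) r^*], because
   [B^2 - A^2 = B (B - A) + (B - A) A]. *)
Lemma psd_sqr_le n (A B : 'M[C]_n) : posdefmx A -> posdefmx B ->
  psdmx (B *m B - A *m A) -> psdmx (B - A).
Proof.
move=> [hA pA] [hB pB] [_ pAB].
have hD : B - A \is hermsymmx.
  by apply/hermP; rewrite trmxCB; congr (_ - _); apply/hermP.
have uQ := spectral_unitarymx (B - A).
have eD := herm_udiag hD.
move: (spectralmx _) uQ eD => Q uQ; move: (fun i => _) => d eD.
rewrite eD; apply: udiag_psd => i.
have r0 := unitary_row_neq0 i uQ; move: r0 (udiag_eigen d i uQ).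
rewrite -eD; set r := row i Q => r0 er.
have er' : (B - A) *m r^t* = (d i)%:C *: r^t*.
  rewrite -{1}(hermP _ hD) -trmxC_mul er; apply/matrixP => a b; rewrite !mxE rmorphM.
  by congr (_ * _); exact: conj_rc.
have := pAB r.
have -> : B *m B - A *m A = B *m (B - A) + (B - A) *m A.
  by rewrite mulmxBr mulmxBl addrA subrK.
rewrite mulmxDr mulmxDl !mulmxA er -[r *m B *m _ *m _]mulmxA er'.
rewrite -!scalemxAl -scalemxAr -scalerDr mxE pmulr_lge0 ?ler0c //.
by rewrite mxE addr_gt0 ?pB ?pA.
Qed.

(** Halving the exponents takes square roots of both operators, and [psd_sqr_le] carries the order
    over to the roots, one halving at a time. *)
Lemma psd_expR_dyadic n (U V : 'M[C]_n) (l m : 'I_n -> R) :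
  U \is unitarymx -> V \is unitarymx ->
  psdmx (udiag V (expR \o m) - udiag U (expR \o l)) ->
  forall k, psdmx (udiag V (fun i => expR (m i / 2 ^+ k))
                   - udiag U (fun i => expR (l i / 2 ^+ k))).
Proof.
move=> uU uV h; elim=> [|k ih].
  have div20 (x : R) : expR (x / 2 ^+ 0) = expR x by rewrite expr0 divr1.
  by rewrite (eq_udiag V (fun i => div20 (m i))) (eq_udiag U (fun i => div20 (l i))).
have posX W (x : 'I_n -> R) : W \is unitarymx ->
    posdefmx (udiag W (fun i => expR (x i / 2 ^+ k.+1))).
  by move=> uW; apply: udiag_posdef => // i; apply: expR_gt0.
apply: (psd_sqr_le (posX _ _ uU) (posX _ _ uV)).
rewrite (udiagM _ _ uU) (udiagM _ _ uV).
have half (x : R) : expR (x / 2 ^+ k.+1) * expR (x / 2 ^+ k.+1) = expR (x / 2 ^+ k).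
  rewrite -expRD; congr expR.
  by rewrite exprS; field; rewrite expf_neq0 ?pnatr_eq0.
by rewrite (eq_udiag V (fun i => half (m i))) (eq_udiag U (fun i => half (l i))).
Qed.

Lemma expRB1_ge (x s : R) : 0 < s -> x <= (expR (x * s) - 1) / s.
Proof. by move=> s0; rewrite ler_pdivlMr // lerBrDl expR_ge1Dx. Qed.

(** With [t = x * s], the bound [1 - t <= expR (- t)] gives [expR t - 1 <= t * expR t = t + t *
    (expR t - 1)]. The last product is at most [t ^+ 2 * expR t] when [t >= 0] and at most [t ^+ 2]
    when [t <= 0]. As [s <= 1], both are at most [t ^+ 2 * expR |x|], whose exponential factor is
    independent of [s]. *)
Lemma expRB1_le (x s : R) : 0 < s -> s <= 1 ->
  (expR (x * s) - 1) / s <= x + x ^+ 2 * expR `|x| * s.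
Proof.
move=> s0 s1; rewrite ler_pdivrMr //.
have e0 := expR_gt0 (x * s).
have h1 : expR (x * s) - 1 <= x * s * expR (x * s).
  have := expR_ge1Dx (- (x * s)); rewrite -(ler_pM2r e0) -expRD addNr expR0.
  lra.
have h2 := expR_ge1Dx (x * s).
have [x0|x0] := leP 0 x.
  have : expR (x * s) <= expR `|x| by rewrite ler_expR ger0_norm // ler_piMr.
  move=> h3.
  have h4 : x * s * (expR (x * s) - 1) <= x * s * (x * s * expR (x * s)).
    by rewrite ler_wpM2l // mulr_ge0 // ltW.
  have h5 : (x * s) ^+ 2 * expR (x * s) <= (x * s) ^+ 2 * expR `|x|.
    by rewrite ler_wpM2l // sqr_ge0.
  lra.
have h3 : 1 <= expR `|x| by rewrite -expR0 ler_expR normr_ge0.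
have h5 : (x * s) ^+ 2 * 1 <= (x * s) ^+ 2 * expR `|x|.
  by rewrite ler_wpM2l // sqr_ge0.
have h4 : x * s * (expR (x * s) - 1) <= x * s * (x * s).
  rewrite ler_wnM2l //; last by lra.
  by rewrite mulr_le0_ge0 // ltW.
lra.
Qed.

Lemma qform_udiag_real n (U : 'M[C]_n) v : U \is unitarymx ->
  exists a : 'I_n -> R, [/\ forall i, 0 <= a i,
    forall d, qform (udiag U d) v = (\sum_i d i * a i)%:C &
    qform 1%:M v = (\sum_i a i)%:C].
Proof.
move=> uU; pose a i : R := complex.Re (`|(v *m U ^t*) 0 i| ^+ 2).
have aE i : `|(v *m U ^t*) 0 i| ^+ 2 = (a i)%:C.
  by rewrite RRe_real // rpredX // normr_real.
have qE d : qform (udiag U d) v = (\sum_i d i * a i)%:C.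
  by rewrite qform_udiag rmorph_sum; apply: eq_bigr => i _; rewrite aE rmorphM.
exists a; split=> // [i|]; first by rewrite -ler0c -aE exprn_ge0.
by rewrite -(udiag1 uU) qE; congr (_%:C); apply: eq_bigr => i _; rewrite mul1r.
Qed.

Lemma ge0_of_dyadic (x K : R) :
  (forall k, - (K / 2 ^+ k) <= x) -> 0 <= x.
Proof.
move=> h; rewrite leNgt; apply/negP => x0.
(* Since [2 ^+ N > N > K / - x], the hypothesis at [N] contradicts [x < 0]. *)
pose N := (Num.truncn (K / - x)).+1.
have := h N; have : K / - x < N%:R by rewrite truncnS_gt.
have : N%:R < 2 ^+ N :> R by rewrite -natrX ltr_nat ltn_expl.
move=> h1 h2; have := lt_trans h2 h1.
rewrite ltr_pdivrMr ?oppr_gt0 // => h3.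
rewrite lerNl ler_pdivlMr ?exprn_gt0 // mulrC => h4.
by have := lt_le_trans h3 h4; rewrite ltxx.
Qed.

Lemma psd_log_le n (U V : 'M[C]_n) (l m : 'I_n -> R) :
  U \is unitarymx -> V \is unitarymx ->
  psdmx (udiag V (expR \o m) - udiag U (expR \o l)) ->
  psdmx (udiag V m - udiag U l).
Proof.
move=> uU uV h.
have hM : udiag V m - udiag U l \is hermsymmx.
  by apply/hermP; rewrite trmxCB; congr (_ - _); apply/hermP/udiag_herm.
split=> // v; rewrite -/(qform _ _).
have [a [a0 aE a1]] := qform_udiag_real v uU.
have [b [b0 bE b1]] := qform_udiag_real v uV.
(* Equal total weights let [1] be subtracted from every exponential on both sides without changing
   the difference of the two sums. *)
have /complexI ab : (\sum_i a i)%:C = (\sum_i b i)%:C :> C by rewrite -a1 -b1.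
rewrite qformB aE bE -rmorphB ler0c.
(* The constant collects the second-order errors of [expRB1_le], weighted by [b]; the error comes
   only from the [V] side, because [expRB1_ge] bounds the [U] side exactly by [l]. *)
apply: (@ge0_of_dyadic _ (\sum_i m i ^+ 2 * expR `|m i| * b i)) => k.
have [_ /(_ v)] := psd_expR_dyadic uU uV h k.
rewrite -/(qform _ _) qformB aE bE -rmorphB ler0c.
have s0 : 0 < (2 ^+ k)^-1 :> R by rewrite invr_gt0 exprn_gt0.
have s1 : (2 ^+ k)^-1 <= 1 :> R by rewrite invf_le1 ?exprn_gt0 // exprn_ege1 // ler1n.
move: (_^-1) s0 s1 => s s0 s1 q.
have : 0 <= (\sum_i (expR (m i * s) - 1) * b i - \sum_i (expR (l i * s) - 1) * a i) / s.
  rewrite divr_ge0 ?(ltW s0) //; move: q.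
  under [X in _ -> 0 <= X - _]eq_bigr do rewrite mulrBl mul1r.
  under [X in _ -> 0 <= _ - X]eq_bigr do rewrite mulrBl mul1r.
  rewrite !sumrB ab; lra.
have -> : (\sum_i (expR (m i * s) - 1) * b i - \sum_i (expR (l i * s) - 1) * a i) / s
  = \sum_i (expR (m i * s) - 1) / s * b i - \sum_i (expR (l i * s) - 1) / s * a i.
  by rewrite mulrBl !mulr_suml; congr (_ - _); apply: eq_bigr => i _; rewrite mulrAC.
have hl : \sum_i l i * a i <= \sum_i (expR (l i * s) - 1) / s * a i.
  by apply: ler_sum => i _; rewrite ler_wpM2r // expRB1_ge.
have hm : \sum_i (expR (m i * s) - 1) / s * b i <=
    \sum_i m i * b i + (\sum_i m i ^+ 2 * expR `|m i| * b i) * s.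
  rewrite mulr_suml -big_split; apply: ler_sum => i _ /=.
  by rewrite [_ * b i * s]mulrAC -mulrDl ler_wpM2r // expRB1_le.
lra.
Qed.

End LogMonotone.

(** * Kronecker products: logarithms and quadratic forms *)

Section Tensor.
Variable R : realType.
Local Notation C := R[i].

Lemma big_mxtens (V : nmodType) m n (F : 'I_(m * n) -> V) :
  \sum_i F i = \sum_i \sum_j F (mxtens_index (i, j)).
Proof.
rewrite pair_big /= (reindex (@mxtens_index m n)) /=; last first.
  by exists (@mxtens_unindex m n) => i _; rewrite ?mxtens_indexK ?mxtens_unindexK.
by apply: eq_bigr => -[].
Qed.

Lemma trmxC_tens m n p q (A : 'M[C]_(m, n)) (B : 'M[C]_(p, q)) :
  (A *t B) ^t* = A ^t* *t B ^t*.
Proof. by rewrite trmx_tens map_mxT. Qed.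

Lemma tensmx1 m n : (1%:M : 'M[C]_m) *t (1%:M : 'M[C]_n) = 1%:M.
Proof.
apply/matrixP=> i j; case: (mxtens_indexP i) => a b; case: (mxtens_indexP j) => c d.
rewrite tensmxE !mxE (can_eq (@mxtens_indexK m n)) xpair_eqE.
by case: (a == c); rewrite ?mul0r ?mul1r.
Qed.

Lemma unitary_tens m n (U : 'M[C]_m) (V : 'M[C]_n) :
  U \is unitarymx -> V \is unitarymx -> U *t V \is unitarymx.
Proof.
move=> /unitarymxP uU /unitarymxP uV; apply/unitarymxP.
by rewrite trmxC_tens tensmx_mul uU uV tensmx1.
Qed.

Lemma udiag_tens m n (U : 'M[C]_m) (V : 'M[C]_n) d e :
  udiag U d *t udiag V e =
  udiag (U *t V) (fun i => d (mxtens_unindex i).1 * e (mxtens_unindex i).2).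
Proof.
rewrite /udiag trmxC_tens -!tensmx_mul.
set D := diag_mx _ *t _; set D' := diag_mx _; suff -> : D = D' by [].
apply/matrixP=> i j; case: (mxtens_indexP i) => a b; case: (mxtens_indexP j) => c k.
rewrite tensmxE !mxE !mxtens_indexK /= (can_eq (@mxtens_indexK m n)) xpair_eqE.
by case: (a == c); case: (b == k); rewrite ?mulr0n ?mul0r ?mulr0 // !mulr1n rmorphM.
Qed.

Lemma udiagD n (U : 'M[C]_n) d e :
  udiag U d + udiag U e = udiag U (fun i => d i + e i).
Proof.
rewrite /udiag -mulmxDl -mulmxDr.
rewrite (_ : diag_mx _ + _ = diag_mx (\row_i (d i + e i)%:C)) //.
by apply/matrixP=> i j; rewrite !mxE -mulrnDl rmorphD.
Qed.

Lemma udiagN n (U : 'M[C]_n) d : - udiag U d = udiag U (fun i => - d i).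
Proof.
rewrite /udiag -mulNmx -mulmxN.
rewrite (_ : - diag_mx _ = diag_mx (\row_i (- d i)%:C)) //.
by apply/matrixP=> i j; rewrite !mxE -mulNrn rmorphN.
Qed.

(** The relation [X = exp L] for Hermitian [L], witnessed by any common eigenbasis. Logarithms of
    inverses, tensor products and casts can then be exhibited directly, without knowing which
    diagonalisation [spectralmx] picks for them. *)
Definition explog n (X L : 'M[C]_n) : Prop :=
  exists U l, [/\ U \is unitarymx, X = udiag U (expR \o l) & L = udiag U l].

Lemma explog_logm n (A : 'M[C]_n) : posdefmx A -> explog A (logm A).
Proof.
move=> pA; pose d i := complex.Re (spectral_diag A 0 i).
have uU := spectral_unitarymx A; have eA : A = udiag _ d := herm_udiag pA.1.
exists (spectralmx A), (fun i => ln (d i)); split; [exact: uU| |by []].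
rewrite {1}eA; apply: eq_udiag => i /=; rewrite lnK // posrE.
by apply: (@posdef_udiag_gt0 _ _ _ d i uU); rewrite -eA.
Qed.

Lemma explog_posdef n (X L : 'M[C]_n) : explog X L -> posdefmx X.
Proof.
move=> [U [l [uU -> _]]]; apply: udiag_posdef => // i; exact: expR_gt0.
Qed.

Lemma explog_le n (X Y L M : 'M[C]_n) : explog X L -> explog Y M ->
  psdmx (Y - X) -> psdmx (M - L).
Proof.
by move=> [U [l [uU -> ->]]] [V [m [uV -> ->]]]; exact: psd_log_le.
Qed.

Lemma udiag_expN n (U : 'M[C]_n) l : U \is unitarymx ->
  udiag U (expR \o l) *m udiag U (expR \o (fun i => - l i)) = 1%:M.
Proof.
move=> uU; rewrite (udiagM _ _ uU) -(udiag1 uU); apply: eq_udiag => i /=.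
by rewrite -expRD addrN expR0.
Qed.

Lemma explog_mulV n (X L : 'M[C]_n) : explog X L -> X *m invmx X = 1%:M.
Proof.
by move=> [U [l [/udiag_expN e -> _]]]; apply: mulmxV; case: (mulmx1_unit (e l)).
Qed.

Lemma explog_inv n (X L : 'M[C]_n) : explog X L -> explog (invmx X) (- L).
Proof.
move=> [U [l [uU -> ->]]]; exists U, (fun i => - l i); split; [exact: uU| |exact: udiagN].
have e := udiag_expN l uU; have [u1 _] := mulmx1_unit e.
by rewrite -[LHS]mulmx1 -e mulKmx.
Qed.

Lemma explog_tens m n (X L : 'M[C]_m) (Y M : 'M[C]_n) :
  explog X L -> explog Y M -> explog (X *t Y) (L *t 1%:M + 1%:M *t M).
Proof.
move=> [U [l [uU -> ->]]] [V [k [uV -> ->]]].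
exists (U *t V), (fun i => l (mxtens_unindex i).1 + k (mxtens_unindex i).2); split.
- exact: unitary_tens.
- by rewrite udiag_tens; apply: eq_udiag => i /=; rewrite expRD.
(* Writing each identity as a constant diagonal in [V] or [U] makes both summands diagonal in the
   same basis [U *t V]. *)
rewrite -{1}(udiag1 uV) -(udiag1 uU) !udiag_tens udiagD.
by apply: eq_udiag => i; rewrite mulr1 mul1r.
Qed.

Lemma explog_cast n n' (e : n = n') (X L : 'M[C]_n) : explog X L ->
  explog (castmx (e, e) X) (castmx (e, e) L).
Proof. by case: n' / e; rewrite !castmx_id. Qed.

Lemma qformE n (A : 'M[C]_n) v :
  qform A v = \sum_i \sum_j v 0 i * A i j * (v 0 j)^*%R.
Proof.
rewrite /qform mxE exchange_big; apply: eq_bigr => j _ /=.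
by rewrite !mxE mulr_suml.
Qed.

Lemma qform_congr m n (B : 'M[C]_(m, n)) A v :
  qform (B *m A *m B ^t*) v = qform A (v *m B).
Proof. by rewrite /qform trmxC_mul !mulmxA. Qed.

(** Contraction with the basis vector [e_j] of the first factor: [x] is the sum over [j] of [e_j]
    tensor [slice j x]. *)
Definition slice m n (j : 'I_m) (x : 'rV[C]_(m * n)) : 'rV[C]_n :=
  \row_b x 0 (mxtens_index (j, b)).

Lemma qform_1tens m n (T : 'M[C]_n) x :
  qform ((1%:M : 'M[C]_m) *t T) x = \sum_j qform T (slice j x).
Proof.
rewrite qformE big_mxtens; apply: eq_bigr => j _; rewrite qformE.
apply: eq_bigr => b _; rewrite big_mxtens (bigD1 j) //= [X in _ + X]big1 ?addr0.
  by apply: eq_bigr => c _; rewrite tensmxE !mxE eqxx mul1r.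
move=> i ij; apply: big1 => c _.
by rewrite tensmxE mxE eq_sym (negbTE ij) mul0r mulr0 mul0r.
Qed.

(** The operator is the congruence by [G^* *t 1] of the block-diagonal [1 *t T], which yields one
    term for each row of [G]. *)
Lemma qform_gram_tens p m n (G : 'M[C]_(p, m)) (T : 'M[C]_n) v :
  qform ((G ^t* *m G) *t T) v =
  \sum_j qform T (slice j (v *m (G ^t* *t 1%:M))).
Proof.
have -> : (G ^t* *m G) *t T = (G ^t* *t 1%:M) *m (1%:M *t T) *m (G ^t* *t 1%:M) ^t*.
  by rewrite trmxC_tens trmxCK trmx1 map_mx1 !tensmx_mul mul1mx !mulmx1.
by rewrite qform_congr qform_1tens.
Qed.

Lemma slice_mul_tens p m n (G : 'M[C]_(m, p)) (v : 'rV[C]_(m * n)) j b :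
  slice j (v *m (G *t 1%:M)) 0 b = \sum_a v 0 (mxtens_index (a, b)) * G a j.
Proof.
rewrite !mxE big_mxtens; apply: eq_bigr => a _.
rewrite (bigD1 b) //= big1 ?addr0 => [|c cb]; rewrite tensmxE mxE.
  by rewrite eqxx mulr1.
by rewrite (negbTE cb) !mulr0.
Qed.

End Tensor.

(** * Partial traces and the operator inequality between the tensor products *)

Section PartialTrace.
Variable R : realType.
Local Notation C := R[i].

(** [embl n i] is the row vector [e_i] tensored with the identity, and [embr m j] is the identity
    tensored with [e_j]. They are the Kraus operators of the two partial traces. *)
Definition embl m n (i : 'I_m) : 'M[C]_(n, m * n) :=
  \matrix_(j, k) (k == mxtens_index (i, j))%:R.
Definition embr m n (j : 'I_n) : 'M[C]_(m, m * n) :=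
  \matrix_(i, k) (k == mxtens_index (i, j))%:R.

Lemma mul_delta_rows m n p (f : 'I_m -> 'I_n) (A : 'M[C]_(n, p)) i j :
  ((\matrix_(i, k) (k == f i)%:R : 'M[C]_(m, n)) *m A) i j = A (f i) j.
Proof.
rewrite mxE (bigD1 (f i)) //= mxE eqxx mul1r big1 ?addr0 // => k kf.
by rewrite mxE (negbTE kf) mul0r.
Qed.

Lemma mul_delta_cols m n p (f : 'I_m -> 'I_n) (A : 'M[C]_(p, n)) i j :
  (A *m (\matrix_(i, k) (k == f i)%:R : 'M[C]_(m, n)) ^t*) i j = A i (f j).
Proof.
rewrite mxE (bigD1 (f j)) //= !mxE eqxx rmorph1 mulr1 big1 ?addr0 // => k kf.
by rewrite !mxE (negbTE kf) rmorph0 mulr0.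
Qed.

Lemma ptrace1E m n (A : 'M[C]_(m * n)) :
  ptrace1 A = \sum_i embl n i *m A *m (embl n i) ^t*.
Proof.
apply/matrixP=> i j; rewrite mxE summxE; apply: eq_bigr => k _.
by rewrite mul_delta_cols mul_delta_rows.
Qed.

Lemma ptrace2E m n (A : 'M[C]_(m * n)) :
  ptrace2 A = \sum_j embr m j *m A *m (embr m j) ^t*.
Proof.
apply/matrixP=> i j; rewrite mxE summxE; apply: eq_bigr => k _.
by rewrite mul_delta_cols mul_delta_rows.
Qed.

Lemma embl_coisometry m n (i : 'I_m) : embl n i *m (embl n i) ^t* = 1%:M.
Proof.
apply/matrixP=> a b; rewrite mul_delta_cols !mxE (can_eq (@mxtens_indexK m n)).
by rewrite xpair_eqE eqxx /= eq_sym.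
Qed.

Lemma embr_coisometry m n (j : 'I_n) : embr m j *m (embr m j) ^t* = 1%:M.
Proof.
apply/matrixP=> a b; rewrite mul_delta_cols !mxE (can_eq (@mxtens_indexK m n)).
by rewrite xpair_eqE eqxx andbT eq_sym.
Qed.

Lemma qform_sum (I : Type) (r : seq I) n (A : I -> 'M[C]_n) v :
  qform (\sum_(i <- r) A i) v = \sum_(i <- r) qform (A i) v.
Proof. by rewrite /qform mulmx_sumr mulmx_suml summxE. Qed.

(** Every summand is positive semidefinite, and the one at [i0] is strictly positive because
    [v *m E i0 = 0] forces [v = 0]. The index [i0] ensures that the sum is not empty. *)
Lemma posdef_sum_congr k m n (E : 'I_k -> 'M[C]_(m, n)) A (i0 : 'I_k) :
  (forall i, E i *m (E i) ^t* = 1%:M) -> posdefmx A ->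
  posdefmx (\sum_i E i *m A *m (E i) ^t*).
Proof.
move=> E1 [hA pA]; split.
  apply/hermP; rewrite linear_sum raddf_sum; apply: eq_bigr => i _ /=.
  by rewrite !trmxC_mul trmxCK (hermP _ hA) mulmxA.
move=> v v0; rewrite -/(qform _ _) qform_sum (bigD1 i0) //= ltr_wpDr //.
  apply: sumr_ge0 => i _; rewrite qform_congr.
  by have [_] := posdef_psd (conj hA pA); apply.
rewrite qform_congr; apply: pA; apply: contra v0 => /eqP vE.
by rewrite -[v]mulmx1 -(E1 i0) mulmxA vE mul0mx.
Qed.

Lemma posdef_ptrace1 m n (A : 'M[C]_(m * n)) : (0 < m)%N ->
  posdefmx A -> posdefmx (ptrace1 A).
Proof.
move=> m0; rewrite ptrace1E; apply: (posdef_sum_congr (Ordinal m0)) => i.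
exact: embl_coisometry.
Qed.

Lemma posdef_ptrace2 m n (A : 'M[C]_(m * n)) : (0 < n)%N ->
  posdefmx A -> posdefmx (ptrace2 A).
Proof.
move=> n0; rewrite ptrace2E; apply: (posdef_sum_congr (Ordinal n0)) => i.
exact: embr_coisometry.
Qed.

Lemma slice_embl m n (i : 'I_m) x : slice i x = x *m (embl n i) ^t*.
Proof. by apply/rowP=> b; rewrite mul_delta_cols mxE. Qed.

(** Completing the square: as [T] is the inverse of [S], nonnegativity of the left side is the
    variational lower bound for [qform T u], attained when [u = y *m S]. *)
Lemma qform_subM n (S T : 'M[C]_n) u y : S ^t* = S -> S *m T = 1%:M ->
  qform T (u - y *m S) =
  qform T u - (u *m y ^t*) 0 0 - (y *m u ^t*) 0 0 + qform S y.
Proof.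
move=> hS ST; have TS := mulmx1C ST.
rewrite /qform trmxCB trmxC_mul hS mulmxBl mulmxBr !mulmxBl.
rewrite -[y *m S *m T]mulmxA ST mulmx1 !mulmxA -[u *m T *m S]mulmxA TS mulmx1.
move: (u *m T *m u ^t*) (u *m y ^t*) (y *m u ^t*) (y *m S *m y ^t*) => a b c d.
by rewrite !mxE; ring.
Qed.

(* Sum over [i] of [T >= u y^* + y u^* - y S y^*] on [u i], where
   [y = z E_i] with [z = w sigma^-1] optimal for the marginal [sigma]. *)
Lemma qform_inv_ptrace1_le m n (S : 'M[C]_(m * n)) (T : 'M[C]_(m * n)) T1
    (u : 'I_m -> 'rV[C]_(m * n)) :
  S \is hermsymmx -> psdmx T -> S *m T = 1%:M ->
  T1 \is hermsymmx -> ptrace1 S *m T1 = 1%:M ->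
  qform T1 (\sum_i slice i (u i)) <= \sum_i qform T (u i).
Proof.
move=> /hermP hS [_ pT] ST /hermP hT1 ST1.
set w := \sum_i _; pose z := w *m T1.
have : 0 <= \sum_i qform T (u i - (z *m embl n i) *m S).
  by apply: sumr_ge0 => i _; exact: pT.
under eq_bigr do rewrite qform_subM //.
rewrite big_split /= !sumrB.
have -> : \sum_i (u i *m (z *m embl n i) ^t*) 0 0 = qform T1 w.
  rewrite -summxE /qform -mulmxA -{1}hT1 -trmxC_mul -/z mulmx_suml.
  by congr ((_ : 'M_1) 0 0); apply: eq_bigr => i _; rewrite slice_embl trmxC_mul mulmxA.
have -> : \sum_i (z *m embl n i *m (u i) ^t*) 0 0 = qform T1 w.
  rewrite -summxE /qform -/z.
  have -> : w ^t* = \sum_i embl n i *m (u i) ^t*.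
    rewrite /w linear_sum raddf_sum; apply: eq_bigr => i _ /=.
    by rewrite slice_embl trmxC_mul trmxCK.
  by rewrite mulmx_sumr; congr ((_ : 'M_1) 0 0); apply: eq_bigr => i _; rewrite mulmxA.
have -> : \sum_i qform S (z *m embl n i) = qform T1 w.
  under eq_bigr do rewrite -qform_congr.
  rewrite -qform_sum -ptrace1E /qform /z -[w *m T1 *m _]mulmxA (mulmx1C ST1) mulmx1.
  by rewrite trmxC_mul hT1 mulmxA.
by rewrite subrK subr_ge0.
Qed.

Lemma qform_cast n n' (e : n = n') (A : 'M[C]_n) v :
  qform (castmx (e, e) A) v = qform A (castmx (erefl, esym e) v).
Proof. by case: n' / e v => v; rewrite !castmx_id. Qed.

Lemma udiag_gram n (U : 'M[C]_n) d : (forall i, 0 <= d i) ->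
  exists G : 'M[C]_n, udiag U d = G ^t* *m G.
Proof.
move=> d0; exists (diag_mx (\row_i (Num.sqrt (d i))%:C) *m U).
rewrite trmxC_mul /udiag -!mulmxA; congr (_ *m _); rewrite mulmxA; congr (_ *m _).
rewrite tr_diag_mx map_diag_mx mulmx_diag; congr diag_mx; apply/rowP=> i.
rewrite !mxE -[in LHS](sqr_sqrtr (d0 i)) expr2 rmorphM; congr (_ * _).
by rewrite [RHS]conj_rc.
Qed.

Lemma herm_tens m n (A : 'M[C]_m) (B : 'M[C]_n) :
  A \is hermsymmx -> B \is hermsymmx -> A *t B \is hermsymmx.
Proof. by move=> /hermP hA /hermP hB; apply/hermP; rewrite trmxC_tens hA hB. Qed.

Lemma herm_cast n n' (e : n = n') (A : 'M[C]_n) :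
  A \is hermsymmx -> castmx (e, e) A \is hermsymmx.
Proof. by case: n' / e; rewrite castmx_id. Qed.

Lemma hermB n (A B : 'M[C]_n) :
  A \is hermsymmx -> B \is hermsymmx -> A - B \is hermsymmx.
Proof. by move=> /hermP hA /hermP hB; apply/hermP; rewrite trmxCB hA hB. Qed.

Lemma posdef_gram n (A : 'M[C]_n) : posdefmx A -> exists G : 'M[C]_n, A = G ^t* *m G.
Proof.
move=> pA; have [U [l [_ -> _]]] := explog_logm pA.
by apply: udiag_gram => i; apply/ltW/expR_gt0.
Qed.

(** [H] reshapes [G], moving the traced index from the columns to the rows. The rows of [H] thus
    come in blocks, one for each row of [G], so that the Gram sums of an operator and of its
    marginal can be compared row by row. *)
Lemma ptrace2_gram p m n (G : 'M[C]_(p, m * n)) :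
  let H : 'M[C]_(p * n, m) := \matrix_(kb, a)
    G (mxtens_unindex kb).1 (mxtens_index (a, (mxtens_unindex kb).2)) in
  ptrace2 (G ^t* *m G) = H ^t* *m H.
Proof.
move=> H; apply/matrixP=> a a'; rewrite !mxE big_mxtens exchange_big.
apply: eq_bigr => b _; rewrite mxE; apply: eq_bigr => k _.
by rewrite !mxE mxtens_indexK.
Qed.

Lemma tens_inv_ptrace_le dA dB dC (rho : 'M[C]_(dA * dB)) (S T : 'M[C]_(dB * dC)) T1 :
  posdefmx rho -> S \is hermsymmx -> psdmx T -> S *m T = 1%:M ->
  T1 \is hermsymmx -> ptrace1 S *m T1 = 1%:M ->
  psdmx (castmx (mulnA dA dB dC, mulnA dA dB dC) (ptrace2 rho *t T) - rho *t T1).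
Proof.
move=> prho hS pT ST hT1 ST1; have [G rhoE] := posdef_gram prho.
have rhoAE := ptrace2_gram G; rewrite -rhoE in rhoAE; move: rhoAE => /=.
set H := (X in X ^t*) => rhoAE.
split=> [|v].
  apply/hermB/herm_tens => //; last exact: prho.1.
  apply/herm_cast/herm_tens; last exact: pT.1.
  by rewrite rhoAE; apply/hermP; rewrite trmxC_mul trmxCK.
rewrite -/(qform _ _) qformB qform_cast rhoAE {1}rhoE !qform_gram_tens.
(* Both forms are now sums over the rows [k] of [G], the right one with an inner sum over the index
   of the B factor; each [k] is treated separately. *)
rewrite subr_ge0 [leRHS]big_mxtens; apply: ler_sum => k _.
set v' := castmx _ v.
pose u b := slice (mxtens_index (k, b)) (v' *m (H ^t* *t 1%:M)).
(* Identifying the B index of row [(k, b)] of [H] with the B index sliced from [u b], and summing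
   over [b], recovers the contraction of [v] with the whole row [k] of [G]. *)
have -> : slice k (v *m (G ^t* *t 1%:M)) = \sum_b slice b (u b).
  apply/rowP=> c; rewrite slice_mul_tens summxE big_mxtens exchange_big.
  apply: eq_bigr => b _; rewrite mxE slice_mul_tens; apply: eq_bigr => a _.
  rewrite /v' castmxE /H !mxE; congr (v _ _ * (G _ (mxtens_index (_, _)))^*%R).
  - exact: val_inj.
  (* Associativity of the index encoding: [(a * dB + b) * dC + c = a * (dB * dC) + (b * dC + c)]. *)
  - by apply: val_inj; rewrite /= mulnDl mulnA addnA.
  - exact: (congr1 fst (esym (mxtens_indexK (k, b)))).
  - exact: (congr1 snd (esym (mxtens_indexK (k, b)))).
exact: qform_inv_ptrace1_le ST hT1 ST1.
Qed.

End PartialTrace.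

(** * From the operator inequality to the inequality of logarithms *)

Theorem theorem1 (R : realType) (dA dB dC : nat)
    (rhoAB : 'M[R[i]]_(dA * dB)) (sigmaBC : 'M[R[i]]_(dB * dC)) :
  density rhoAB -> posdefmx rhoAB ->
  density sigmaBC -> posdefmx sigmaBC ->
  psdmx (- (logm rhoAB *t (1%:M : 'M[R[i]]_dC)
            - castmx (mulnA dA dB dC, mulnA dA dB dC)
                (logm (ptrace2 rhoAB) *t (1%:M : 'M[R[i]]_(dB * dC)))
            + castmx (mulnA dA dB dC, mulnA dA dB dC)
                ((1%:M : 'M[R[i]]_dA) *t logm sigmaBC)
            - (1%:M : 'M[R[i]]_(dA * dB)) *t logm (ptrace1 sigmaBC))).
Proof.
move=> _ pR [_ trS] pS.
(* For [dB = 0] the trace of [sigmaBC] would be an empty sum, not one. Nonzero [dB] makes both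
   marginals positive definite. *)
have dB0 : (0 < dB)%N.
  case: (posnP dB) => // dB0; move: trS; rewrite /mxtrace big1 => [/eqP|i].
    by rewrite eq_sym oner_eq0.
  by have := leq_ltn_trans (leq0n _) (ltn_ord (mxtens_unindex i).1); rewrite {1}dB0.
have pRA := posdef_ptrace2 dB0 pR; have pSC := posdef_ptrace1 dB0 pS.
have lS := explog_inv (explog_logm pS); have lSC := explog_inv (explog_logm pSC).
have unitS n (A : 'M[R[i]]_n) : posdefmx A -> A *m invmx A = 1%:M.
  move=> /explog_logm/explog_mulV //.
have := tens_inv_ptrace_le pR pS.1 (posdef_psd (explog_posdef lS)) (unitS _ _ pS)
  (explog_posdef lSC).1 (unitS _ _ pSC).
(* The logarithms of the two sides are found by additivity over tensor factors, with a sign change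
   for the inverses of [sigmaBC] and of its marginal. *)
move=> /(explog_le (explog_tens (explog_logm pR) lSC)
  (explog_cast (mulnA dA dB dC) (explog_tens (explog_logm pRA) lS))).
(* With the logarithms abstracted, what remains is an entrywise rearrangement of signs, the cast
   merely renaming indices. *)
move: (logm rhoAB) (logm (ptrace2 _)) (logm sigmaBC) (logm (ptrace1 _)) => a b c d.
congr psdmx; apply/matrixP=> i j; rewrite !(mxE, castmxE); ring.
Qed.
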